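(* Let $f_1,\dots,f_h$ ($h\ge 2$) be germs of biholomorphisms of $\mathbb{C}^n$ fixing the origin, each formally linearizable, with simultaneously diagonalizable linear parts. Then $f_1,\dots,f_h$ are simultaneously formally linearizable if and only if $f_p\circ f_q=f_q\circ f_p$ for all $p,q\in\{1,\dots,h\}$.
   Context: A germ $f$ fixing $0$ is formally linearizable if there is an invertible formal power series map $\varphi$ with $\varphi(0)=0$ such that $\varphi^{-1}\circ f\circ\varphi$ is linear; $f_1,\dots,f_h$ are simultaneously formally linearizable if a single such $\varphi$ makes all $\varphi^{-1}\circ f_k\circ\varphi$ linear. Commutation of germs is understood as equality of germs (equivalently of formal power series) at the origin. *)

(* Defs.v *)
From HB Require Import structures.
From mathcomp Require Import all_boot all_order all_algebra.
Set Implicit Arguments. Unset Strict Implicit. Unset Printing Implicit Defensive.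
Import Order.TTheory GRing.Theory Num.Theory.
Local Open Scope ring_scope.

Definition mi (n : nat) := {ffun 'I_n -> nat}.
Definition mi0 {n} : mi n := [ffun _ => 0%N].
Definition mie {n} (j : 'I_n) : mi n := [ffun k => nat_of_bool (k == j)].
Definition deg {n} (a : mi n) : nat := (\sum_(i < n) a i)%N.
Definition mi_of {n d} (b : {ffun 'I_n -> 'I_d}) : mi n := [ffun i => nat_of_ord (b i)].
Definition midiff {n} (a g : mi n) : mi n := [ffun i => (a i - g i)%N].

(* formal power series in n variables: coefficient function *)
Definition ps (R : Type) (n : nat) := mi n -> R.
Definition psmap (R : Type) (n : nat) := 'I_n -> ps R n.

Section Series.
Variable R : comNzRingType.
Variable n : nat.

Definition psone : ps R n := fun a => (a == mi0)%:R.

(* Cauchy product; every g <= a has entries <= deg a *)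
Definition psmul (P Q : ps R n) : ps R n := fun a =>
  \sum_(g : {ffun 'I_n -> 'I_(deg a).+1} | [forall i, (g i <= a i)%N])
     P (mi_of g) * Q (midiff a (mi_of g)).

Definition psexp (P : ps R n) (k : nat) : ps R n := iter k (psmul P) psone.

Definition monpow (G : psmap R n) (b : mi n) : ps R n :=
  \big[psmul/psone]_(j < n) psexp (G j) (b j).

(* F o G, for G with zero constant terms: only b with |b| <= |a| contribute
   to the coefficient of x^a *)
Definition pscomp (F : ps R n) (G : psmap R n) : ps R n := fun a =>
  \sum_(b : {ffun 'I_n -> 'I_(deg a).+1}) F (mi_of b) * monpow G (mi_of b) a.

Definition mapcomp (F G : psmap R n) : psmap R n := fun i => pscomp (F i) G.

Definition psid : psmap R n := fun i a => (a == mie i)%:R.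

Definition meq (F G : psmap R n) : Prop := forall i a, F i a = G i a.

Definition fixes0 (F : psmap R n) : Prop := forall i, F i mi0 = 0.

Definition is_linear_map (F : psmap R n) : Prop :=
  forall i a, deg a <> 1%N -> F i a = 0.

Definition linpart (F : psmap R n) : 'M[R]_n := \matrix_(i, j) F i (mie j).

Definition formal_inverse (phi psi : psmap R n) : Prop :=
  fixes0 phi /\ fixes0 psi /\ meq (mapcomp phi psi) psid /\ meq (mapcomp psi phi) psid.

Definition formally_linearizable (F : psmap R n) : Prop :=
  exists phi psi, formal_inverse phi psi /\ is_linear_map (mapcomp psi (mapcomp F phi)).

Definition simult_formally_linearizable (h : nat) (f : 'I_h -> psmap R n) : Prop :=
  exists phi psi, formal_inverse phi psi /\
    forall k, is_linear_map (mapcomp psi (mapcomp (f k) phi)).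

End Series.

Section Germs.
Variable C : numClosedFieldType.
Variable n : nat.

(* convergent power series map (Cauchy estimates), i.e. a holomorphic germ *)
Definition convergent (F : psmap C n) : Prop :=
  exists M r : C, 0 < M /\ 0 < r /\ forall i a, `|F i a| <= M * r ^+ deg a.

Definition germ_biholo_0 (F : psmap C n) : Prop :=
  fixes0 F /\ convergent F /\
  exists G, convergent G /\ formal_inverse F G.

Definition simult_diag_linparts (h : nat) (f : 'I_h -> psmap C n) : Prop :=
  exists P : 'M[C]_n, P \in unitmx /\
    forall k, is_diag_mx (P *m linpart (f k) *m invmx P).

End Germs.

(* Main.v *)
Require Import Defs.
From HB Require Import structures.
From mathcomp Require Import all_boot all_order all_algebra.
From Stdlib Require Import FunctionalExtensionality.
Import Order.TTheory GRing.Theory Num.Theory.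
Local Open Scope ring_scope.

(** The semiconjugacy equation psi o f_k = D_k o psi, with D_k the diagonal form
    of the linear part of f_k, is linear in psi.  Starting from a linear psi, the
    equations are solved one k at a time.  If psi_k = phi_k^-1 solves the k-th
    equation, then the maps psi_k o f_j o phi_k commute with D_k, so they contain
    only D_k-resonant monomials, and right composition with them commutes with the
    projection pi_k onto the D_k-resonant terms.  Hence replacing psi by
    pi_k(psi o phi_k) o psi_k preserves the equations already solved, solves the
    k-th one, and does not change the linear part. *)

Set Implicit Arguments.
Unset Strict Implicit.
Unset Printing Implicit Defensive.

(** * Finite sums over lists of indices *)

Section FiniteSums.
Variables (V : nmodType) (T : eqType).

(** Serves to change index sets: products and compositions are defined by sums over boxes, while the
    proofs use truncation by total degree, and the two differ only where the summand vanishes. *)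
Lemma eq_big_support (s t : seq T) (F : T -> V) :
  uniq s -> uniq t -> (forall x, F x != 0 -> (x \in s) = (x \in t)) ->
  \sum_(x <- s) F x = \sum_(x <- t) F x.
Proof.
move=> us ut st.
have nz r : \sum_(x <- r) F x = \sum_(x <- [seq x <- r | F x != 0]) F x.
  rewrite big_filter [RHS]big_mkcond; apply: eq_bigr => x _.
  by case: eqVneq => // ->.
rewrite nz [RHS]nz; apply: perm_big; apply: uniq_perm; rewrite ?filter_uniq //.
by move=> x; rewrite !mem_filter; case: (boolP (F x != 0)) => // /st ->.
Qed.

End FiniteSums.

Lemma sum_delta (R : pzSemiRingType) (T : eqType) (s : seq T) (F : T -> R) x :
  uniq s -> \sum_(y <- s) F y * (y == x)%:R = F x * (x \in s)%:R.
Proof.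
move=> us; case: (boolP (x \in s)) => xs; last first.
  rewrite mulr0 big_seq big1 // => y ys; case: eqVneq => [yx|]; rewrite ?mulr0 //.
  by rewrite -yx ys in xs.
rewrite (bigD1_seq x) //= eqxx big1 ?addr0 // => y /negPf ->.
by rewrite mulr0.
Qed.

(** * Multi-indices, boxes and truncation by total degree *)

Section MultiIndices.
Variable n : nat.
Implicit Types a b c : mi n.

Definition miadd a b : mi n := [ffun i => (a i + b i)%N].

Lemma miaddC : commutative miadd.
Proof. by move=> a b; apply/ffunP=> i; rewrite !ffunE addnC. Qed.

Lemma miaddA : associative miadd.
Proof. by move=> a b c; apply/ffunP=> i; rewrite !ffunE addnA. Qed.

Lemma mi0add : left_id mi0 miadd.
Proof. by move=> a; apply/ffunP=> i; rewrite !ffunE. Qed.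

Lemma deg_miadd a b : deg (miadd a b) = (deg a + deg b)%N.
Proof. by rewrite /deg -big_split; apply: eq_bigr => i _; rewrite ffunE. Qed.

Lemma deg_mi0 : deg (@mi0 n) = 0%N.
Proof. by rewrite /deg big1 // => i _; rewrite ffunE. Qed.

Lemma deg_mie j : deg (@mie n j) = 1%N.
Proof.
rewrite /deg (bigD1 j) //= ffunE eqxx big1 // => i /negPf ij.
by rewrite ffunE ij.
Qed.

Lemma leq_deg a i : (a i <= deg a)%N.
Proof. by rewrite /deg (bigD1 i) //= leq_addr. Qed.

Lemma deg_eq0 a : deg a = 0%N -> a = mi0.
Proof.
move=> a0; apply/ffunP=> i; rewrite ffunE.
by apply/eqP; rewrite -leqn0 -a0 leq_deg.
Qed.

Lemma deg_eq1 a : deg a = 1%N -> exists j, a = mie j.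
Proof.
move=> a1; case: (pickP (fun i => a i != 0%N)) => [j aj|a0]; last first.
  by move: a1; rewrite /deg big1 // => i _; apply/eqP; move: (a0 i) => /negbFE.
exists j; apply/ffunP=> i; rewrite ffunE.
have := a1; rewrite /deg (bigD1 j) //=.
case: (a j) aj => // k _; rewrite addSn => -[] /eqP.
rewrite addn_eq0 => /andP [/eqP k0 /eqP s0].
case: (eqVneq i j) => [->|ij].
  have := a1; rewrite /deg (bigD1 j) //= s0 addn0 => ->; by [].
by apply/eqP; move: s0 => /eqP; rewrite sum_nat_eq0 => /forallP /(_ i); rewrite ij.
Qed.

Lemma mie_inj : injective (@mie n).
Proof.
move=> i j /ffunP /(_ i); rewrite !ffunE eqxx.
by case: eqVneq.
Qed.

Definition mibox d : seq (mi n) := [seq mi_of b | b : {ffun 'I_n -> 'I_d.+1}].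

Lemma mi_of_inj d : injective (@mi_of n d).
Proof.
move=> b c /ffunP bc; apply/ffunP=> i; apply: val_inj.
by have := bc i; rewrite !ffunE.
Qed.

Lemma mibox_uniq d : uniq (mibox d).
Proof. by rewrite map_inj_uniq ?enum_uniq //; apply: mi_of_inj. Qed.

Lemma mem_mibox d a : (a \in mibox d) = [forall i, a i <= d]%N.
Proof.
apply/imageP/forallP => [[b _ ->] i|ad]; first by rewrite ffunE -ltnS.
exists [ffun i => inord (a i)] => //; apply/ffunP=> i.
by rewrite !ffunE inordK // ltnS.
Qed.

(** The bound [N] is kept free of any particular coefficient, so nested sums can share one index
    set. *)
Definition midegs N : seq (mi n) := [seq b <- mibox N | deg b <= N]%N.

Lemma midegs_uniq N : uniq (midegs N).
Proof. by rewrite filter_uniq ?mibox_uniq. Qed.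

Lemma mem_midegs N a : (a \in midegs N) = (deg a <= N)%N.
Proof.
rewrite mem_filter mem_mibox; case: leqP => //= aN.
by apply/forallP => i; apply: leq_trans aN; apply: leq_deg.
Qed.

End MultiIndices.

(** * The commutative monoid of power series under the Cauchy product *)

Section PowerSeries.
Variables (R : comNzRingType) (n : nat).
Implicit Types (a b c : mi n) (P Q S : ps R n) (F G H : psmap R n).

(** Replaces the subtraction [midiff] by a Kronecker delta, so that both factors play symmetric
    roles and sums can be interchanged freely. *)
Lemma psmulE N P Q a : (deg a <= N)%N ->
  psmul P Q a =
  \sum_(b <- midegs n N) \sum_(c <- midegs n N) P b * Q c * (a == miadd b c)%:R.
Proof.
move=> aN.
pose E b := if [forall i, b i <= a i]%N then P b * Q (midiff a b) else 0.
transitivity (\sum_(b <- mibox n (deg a)) E b).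
  rewrite /psmul big_mkcond /mibox big_map big_enum /=; apply: eq_bigr => b _.
  rewrite /E; congr (if _ then _ else _).
  by apply: eq_forallb => i; rewrite ffunE.
transitivity (\sum_(b <- midegs n N) E b).
  apply: eq_big_support; rewrite ?mibox_uniq ?midegs_uniq // => b.
  rewrite /E; case: forallP => [ba _|]; last by rewrite eqxx.
  rewrite mem_mibox mem_midegs.
  have -> : (deg b <= N)%N.
    by apply: leq_trans aN; apply: leq_sum => i _; apply: ba.
  by apply/forallP => i; apply: leq_trans (ba i) (leq_deg a i).
apply: eq_bigr => b _; rewrite /E; case: forallP => ba.
  have ab c : (a == miadd b c) = (c == midiff a b).
    apply/eqP/eqP => [->|->]; apply/ffunP => i; rewrite !ffunE.
      by rewrite addKn.
    by rewrite subnKC.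
  under eq_bigr do rewrite ab.
  rewrite sum_delta ?midegs_uniq // mem_midegs.
  rewrite (leq_trans _ aN) ?mulr1 //.
  by apply: leq_sum => i _; rewrite ffunE leq_subr.
rewrite big1 // => c _; case: eqP => [abc|]; rewrite ?mulr0 //.
by case: ba => i; rewrite abc ffunE leq_addr.
Qed.

Lemma psmulC : commutative (@psmul R n).
Proof.
move=> P Q; apply: functional_extensionality => a.
rewrite !(psmulE _ _ (leqnn _)) exchange_big.
by apply: eq_bigr => b _; apply: eq_bigr => c _; rewrite miaddC [P _ * _]mulrC.
Qed.

Lemma psmul3E P Q S a : psmul P (psmul Q S) a =
  \sum_(b <- midegs n (deg a)) \sum_(c <- midegs n (deg a))
  \sum_(d <- midegs n (deg a)) P b * Q c * S d * (a == miadd b (miadd c d))%:R.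
Proof.
rewrite (psmulE _ _ (leqnn _)); apply: eq_bigr => b _.
transitivity (\sum_(e <- midegs n (deg a)) \sum_(c <- midegs n (deg a))
  \sum_(d <- midegs n (deg a)) P b * Q c * S d * (a == miadd b e)%:R
     * (e == miadd c d)%:R).
  rewrite big_seq [RHS]big_seq; apply: eq_bigr => e; rewrite mem_midegs => eN.
  rewrite (psmulE _ _ eN) mulr_sumr mulr_suml; apply: eq_bigr => c _.
  rewrite mulr_sumr mulr_suml; apply: eq_bigr => d _.
  by rewrite !mulrA -!mulrA [X in _ * (_ * (_ * X))]mulrC !mulrA.
rewrite exchange_big; apply: eq_bigr => c _.
rewrite exchange_big; apply: eq_bigr => d _.
(* The inner index is forced to be [miadd c d], and it lies in the truncation as soon as it is a
   summand of [a]. *)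
rewrite sum_delta ?midegs_uniq // mem_midegs.
case: eqP => [abc|]; last by rewrite mulr0 mul0r.
by rewrite abc (deg_miadd b) leq_addl mulr1.
Qed.

Lemma psmulA : associative (@psmul R n).
Proof.
move=> P Q S; apply: functional_extensionality => a.
rewrite [RHS](congr1 (fun T => T a) (psmulC _ _)) !psmul3E [RHS]exchange_big.
apply: eq_bigr => b _; rewrite [RHS]exchange_big.
apply: eq_bigr => c _; apply: eq_bigr => d _.
rewrite [miadd d _]miaddC -miaddA; congr (_ * _).
by rewrite mulrC mulrA.
Qed.

Definition mono r b : ps R n := fun a => r * (a == b)%:R.

Lemma mono_psmul r s b c : psmul (mono r b) (mono s c) = mono (r * s) (miadd b c).
Proof.
apply: functional_extensionality => a.
rewrite (@psmulE (maxn (deg a) (maxn (deg b) (deg c)))) ?leq_maxl //.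
set N := maxn _ _.
transitivity (\sum_(u <- midegs n N) (\sum_(v <- midegs n N)
  r * s * (a == miadd u v)%:R * (v == c)%:R) * (u == b)%:R).
  apply: eq_bigr => u _; rewrite mulr_suml; apply: eq_bigr => v _.
  by rewrite /mono mulrACA -!mulrA; do 2!congr (_ * _); rewrite mulrC (mulrC (v == c)%:R) mulrA.
rewrite sum_delta ?midegs_uniq // sum_delta ?midegs_uniq //.
by rewrite !mem_midegs !leq_max !leqnn !orbT !mulr1.
Qed.

Lemma psoneE : @psone R n = mono 1 mi0.
Proof. by apply: functional_extensionality => a; rewrite /mono mul1r. Qed.

Lemma psmul1 : left_id (@psone R n) (@psmul R n).
Proof.
move=> P; apply: functional_extensionality => a.
rewrite (psmulE _ _ (leqnn _)) exchange_big.
transitivity (\sum_(c <- midegs n (deg a)) P c * (c == a)%:R).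
  apply: eq_bigr => c _.
  transitivity (\sum_(b <- midegs n (deg a)) P c * (a == miadd b c)%:R * (b == mi0)%:R).
    by apply: eq_bigr => b _; rewrite /psone -mulrA mulrC.
  by rewrite sum_delta ?midegs_uniq // mem_midegs deg_mi0 mulr1 mi0add eq_sym.
by rewrite sum_delta ?midegs_uniq // mem_midegs leqnn mulr1.
Qed.

HB.instance Definition _ :=
  Monoid.isComLaw.Build (ps R n) (@psone R n) (@psmul R n) psmulA psmulC psmul1.

(** * Monomials in the components of a map, and their leading forms *)

Lemma psexpD P k l : psexp P (k + l) = psmul (psexp P k) (psexp P l).
Proof. by elim: k => [|k IH]; rewrite ?psmul1 // addSn /= IH psmulA. Qed.

Lemma monpow_add G b c : monpow G (miadd b c) = psmul (monpow G b) (monpow G c).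
Proof.
by rewrite /monpow -big_split /=; apply: eq_bigr => j _; rewrite ffunE psexpD.
Qed.

Lemma monpow0 G : monpow G mi0 = @psone R n.
Proof. by rewrite /monpow big1 // => j _; rewrite ffunE. Qed.

Lemma monpow_mie G j : monpow G (mie j) = G j.
Proof.
rewrite /monpow (bigD1 j) //= ffunE eqxx big1 => [|i /negPf ij].
  by rewrite /= !Monoid.mulm1.
by rewrite ffunE ij.
Qed.

(** Both series have order at least [k] and the same homogeneous part of degree [k]. *)
Definition eq_lead k P Q :=
  (forall a, (deg a <= k)%N -> P a = Q a) /\ (forall a, (deg a < k)%N -> P a = 0).

(** In degree at most [k + l], a pair [b], [c] has [deg b < k], or [deg c < l], or [deg b = k] and
    [deg c <= l]. The first two kinds contribute zero on both sides, and in the third the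
    coefficients agree. *)
Lemma eq_lead_psmul k l P P' Q Q' :
  eq_lead k P P' -> eq_lead l Q Q' -> eq_lead (k + l) (psmul P Q) (psmul P' Q').
Proof.
move=> [PP P0] [QQ Q0].
have term b c : (deg b + deg c <= k + l)%N -> P b * Q c = P' b * Q' c.
  case: (ltngtP (deg b) k) => bk le_bc.
  - by rewrite -PP ?P0 ?mul0r // ltnW.
  - have cl : (deg c < l)%N.
      by rewrite -(ltn_add2l k); apply: leq_trans le_bc; rewrite ltn_add2r.
    by rewrite -(QQ c) ?Q0 ?mulr0 // ltnW.
  - by rewrite bk leq_add2l in le_bc; rewrite -PP ?bk // -QQ.
split=> a ak; rewrite !(psmulE _ _ (leqnn _)).
  apply: eq_bigr => b _; apply: eq_bigr => c _.
  case: eqP => [abc|]; rewrite ?mulr0 // term //.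
  by rewrite -deg_miadd -abc.
rewrite big1 // => b _; rewrite big1 // => c _.
case: eqP => [abc|]; rewrite ?mulr0 // mulr1.
case: (ltnP (deg b) k) => bk; first by rewrite P0 ?mul0r.
rewrite Q0 ?mulr0 // -(ltn_add2l k).
by apply: leq_ltn_trans ak; rewrite abc deg_miadd leq_add2r.
Qed.

Lemma eq_lead_monpow F G b :
  (forall j, eq_lead 1 (F j) (G j)) -> eq_lead (deg b) (monpow F b) (monpow G b).
Proof.
move=> FG; rewrite /monpow /deg.
apply: (big_ind3 (fun P Q k => eq_lead k P Q)) => //.
  by move=> P Q k P' Q' l; apply: eq_lead_psmul.
move=> j _; elim: (b j) => [//|k IH].
by rewrite -add1n /=; apply: eq_lead_psmul.
Qed.

Lemma eq_lead1 P Q : (forall a, (deg a <= 1)%N -> P a = Q a) -> P mi0 = 0 -> eq_lead 1 P Q.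
Proof.
by move=> PQ P0; split=> // a; rewrite ltnS leqn0 => /eqP /deg_eq0 ->.
Qed.

(** Each component of [G] has order at least 1, so the product has order at least [deg b]. This
    makes composition a finite sum in each coefficient. *)
Lemma monpow_eq0 G b a : fixes0 G -> (deg a < deg b)%N -> monpow G b a = 0.
Proof. by move=> G0; apply: (proj2 (@eq_lead_monpow G G b _)) => j; apply: eq_lead1. Qed.

(** * Composition: compatibility with products, associativity *)

Lemma pscompE N P G a : fixes0 G -> (deg a <= N)%N ->
  pscomp P G a = \sum_(b <- midegs n N) P b * monpow G b a.
Proof.
move=> G0 aN.
transitivity (\sum_(b <- mibox n (deg a)) P b * monpow G b a).
  by rewrite /pscomp /mibox big_map big_enum.
apply: eq_big_support; rewrite ?mibox_uniq ?midegs_uniq // => b.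
case: (ltnP (deg a) (deg b)) => [ab|ba _]; first by rewrite monpow_eq0 ?mulr0 ?eqxx.
rewrite mem_mibox mem_midegs (leq_trans ba aN).
by apply/forallP => i; apply: leq_trans ba; apply: leq_deg.
Qed.

Lemma pscomp_mono r b G : fixes0 G -> pscomp (mono r b) G = fun a => r * monpow G b a.
Proof.
move=> G0; apply: functional_extensionality => a.
rewrite (pscompE _ G0 (leq_maxl (deg a) (deg b))).
under eq_bigr => c _ do rewrite /mono -mulrA [_%:R * _]mulrC mulrA.
by rewrite sum_delta ?midegs_uniq // mem_midegs leq_maxr mulr1.
Qed.

Lemma pscomp_psmul P Q G : fixes0 G ->
  pscomp (psmul P Q) G = psmul (pscomp P G) (pscomp Q G).
Proof.
move=> G0; apply: functional_extensionality => a; set N := deg a.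
transitivity (\sum_(b <- midegs n N) \sum_(c <- midegs n N)
   P b * Q c * psmul (monpow G b) (monpow G c) a).
  rewrite (pscompE _ G0 (leqnn _)).
  transitivity (\sum_(e <- midegs n N) \sum_(b <- midegs n N)
    \sum_(c <- midegs n N) P b * Q c * monpow G e a * (e == miadd b c)%:R).
    rewrite big_seq [RHS]big_seq; apply: eq_bigr => e; rewrite mem_midegs => eN.
    rewrite (psmulE _ _ eN) mulr_suml; apply: eq_bigr => b _.
    by rewrite mulr_suml; apply: eq_bigr => c _; rewrite mulrAC.
  rewrite exchange_big; apply: eq_bigr => b _.
  rewrite exchange_big; apply: eq_bigr => c _.
  rewrite sum_delta ?midegs_uniq // mem_midegs -monpow_add.
  (* An index [miadd b c] beyond the truncation is absent from the left sum, and its monomial in [G]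
     has order too high to reach [a]. *)
  case: leqP => [|lt]; first by rewrite mulr1.
  by rewrite monpow_eq0 ?mulr0.
transitivity (\sum_(u <- midegs n N) \sum_(v <- midegs n N) \sum_(b <- midegs n N)
   \sum_(c <- midegs n N) P b * Q c * (monpow G b u * monpow G c v * (a == miadd u v)%:R)).
  under [RHS]eq_bigr => u _ do rewrite exchange_big.
  rewrite [RHS]exchange_big; apply: eq_bigr => b _.
  under [RHS]eq_bigr => u _ do rewrite exchange_big.
  rewrite [RHS]exchange_big; apply: eq_bigr => c _.
  rewrite (psmulE _ _ (leqnn _)) mulr_sumr; apply: eq_bigr => u _.
  by rewrite mulr_sumr.
rewrite (psmulE _ _ (leqnn _)) big_seq [RHS]big_seq; apply: eq_bigr => u.
rewrite mem_midegs => uN; rewrite big_seq [RHS]big_seq; apply: eq_bigr => v.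
rewrite mem_midegs => vN; rewrite (pscompE P G0 uN) (pscompE Q G0 vN).
rewrite mulr_suml mulr_suml; apply: eq_bigr => b _.
rewrite mulr_sumr mulr_suml; apply: eq_bigr => c _.
by rewrite !mulrA; congr (_ * _); rewrite -!mulrA; congr (_ * _); rewrite mulrCA.
Qed.

Lemma pscomp_psone G : fixes0 G -> pscomp (@psone R n) G = @psone R n.
Proof.
move=> G0; rewrite psoneE pscomp_mono // monpow0 psoneE.
by apply: functional_extensionality => a; rewrite mul1r.
Qed.

Lemma pscomp_monpow F G b : fixes0 G ->
  pscomp (monpow F b) G = monpow (mapcomp F G) b.
Proof.
move=> G0; rewrite /monpow.
rewrite (big_morph (fun P => pscomp P G) (id1 := @psone R n) (op1 := @psmul R n)).
- apply: eq_bigr => j _; elim: (b j) => [|k IH]; first exact: pscomp_psone.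
  by rewrite /= pscomp_psmul // IH.
- by move=> P Q; apply: pscomp_psmul.
- exact: pscomp_psone.
Qed.

Lemma psmap_eq F G : meq F G -> F = G.
Proof.
by move=> FG; do 2!apply: functional_extensionality => ?; apply: FG.
Qed.

Lemma fixes0_comp F G : fixes0 F -> fixes0 G -> fixes0 (mapcomp F G).
Proof.
move=> F0 G0 i; rewrite /mapcomp (pscompE _ G0 (leqnn _)) big_seq big1 // => b.
by rewrite mem_midegs deg_mi0 leqn0 => /eqP /deg_eq0 ->; rewrite F0 mul0r.
Qed.

(** Substituting [H] into the monomial [monpow G b] gives the same monomial in [mapcomp G H]; the
    rest is an interchange of finite sums. *)
Lemma mapcompA F G H : fixes0 G -> fixes0 H ->
  mapcomp F (mapcomp G H) = mapcomp (mapcomp F G) H.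
Proof.
move=> G0 H0; apply: psmap_eq => i a; rewrite /mapcomp.
rewrite (pscompE _ H0 (leqnn _)) (pscompE _ (fixes0_comp G0 H0) (leqnn _)).
transitivity (\sum_(c <- midegs n (deg a)) \sum_(b <- midegs n (deg a))
  F i b * (monpow G b c * monpow H c a)).
  rewrite exchange_big; apply: eq_bigr => b _.
  by rewrite -pscomp_monpow // (pscompE _ H0 (leqnn _)) mulr_sumr.
rewrite big_seq [RHS]big_seq; apply: eq_bigr => c; rewrite mem_midegs => ca.
rewrite (pscompE _ G0 ca) mulr_suml.
by apply: eq_bigr => b _; rewrite mulrA.
Qed.

(** * Diagonal linear maps and the identity *)

Lemma psexp_mono r b k : psexp (mono r b) k = mono (r ^+ k) [ffun i => (k * b i)%N].
Proof.
elim: k => [|k IH]; rewrite /= ?psoneE ?IH ?mono_psmul.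
  by congr mono; apply/ffunP => i; rewrite !ffunE mul0n.
by rewrite exprS; congr mono; apply/ffunP => i; rewrite !ffunE mulSn.
Qed.

(** The eigenvalue of the monomial of exponent [b] under right composition with [diagmap d]. *)
Definition weight (d : 'I_n -> R) b : R := \prod_(j < n) d j ^+ b j.

Definition diagmap (d : 'I_n -> R) : psmap R n := fun i => mono (d i) (mie i).

Lemma big_psmul_mono (I : Type) (r : seq I) (c : I -> R) (m : I -> mi n) :
  \big[@psmul R n/@psone R n]_(j <- r) mono (c j) (m j) =
  mono (\prod_(j <- r) c j) [ffun i => (\sum_(j <- r) m j i)%N].
Proof.
elim: r => [|j r IH].
  by rewrite !big_nil psoneE; congr mono; apply/ffunP => i; rewrite !ffunE big_nil.
rewrite !big_cons IH mono_psmul; congr mono; apply/ffunP => i.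
by rewrite !ffunE big_cons.
Qed.

Lemma monpow_diagmap d b : monpow (diagmap d) b = mono (weight d b) b.
Proof.
rewrite /monpow; under eq_bigr => j _ do rewrite psexp_mono.
rewrite big_psmul_mono; congr mono; apply/ffunP => i; rewrite ffunE.
rewrite (bigD1 i) //= !ffunE eqxx muln1 big1 ?addn0 // => j /negPf ji.
by rewrite !ffunE eq_sym ji muln0.
Qed.

Lemma fixes0_diagmap d : fixes0 (diagmap d).
Proof.
move=> i; rewrite /diagmap /mono; case: eqP => [/(congr1 deg)|]; last by rewrite mulr0.
by rewrite deg_mi0 deg_mie.
Qed.

Lemma pscomp_diagmap P d a : pscomp P (diagmap d) a = weight d a * P a.
Proof.
rewrite (pscompE _ (@fixes0_diagmap d) (leqnn _)).
transitivity (\sum_(b <- midegs n (deg a)) P b * weight d b * (b == a)%:R).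
  by apply: eq_bigr => b _; rewrite monpow_diagmap /mono eq_sym mulrA.
by rewrite sum_delta ?midegs_uniq // mem_midegs leqnn mulr1 mulrC.
Qed.

Lemma diagmap_comp d G i a : fixes0 G -> mapcomp (diagmap d) G i a = d i * G i a.
Proof. by move=> G0; rewrite /mapcomp pscomp_mono // monpow_mie. Qed.

Lemma psidE : @psid R n = diagmap (fun _ => 1).
Proof. by apply: psmap_eq => i a; rewrite /diagmap /mono mul1r. Qed.

Lemma fixes0_psid : fixes0 (@psid R n).
Proof. by rewrite psidE; apply: fixes0_diagmap. Qed.

Lemma mapcomp_idr F : mapcomp F (@psid R n) = F.
Proof.
apply: psmap_eq => i a; rewrite psidE /mapcomp pscomp_diagmap /weight big1 ?mul1r // => j _.
by rewrite expr1n.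
Qed.

Lemma mapcomp_idl G : fixes0 G -> mapcomp (@psid R n) G = G.
Proof. by move=> G0; apply: psmap_eq => i a; rewrite psidE diagmap_comp // mul1r. Qed.

(** * Linear maps, matrices and the chain rule at the origin *)

Definition linmap (A : 'M[R]_n) : psmap R n :=
  fun i a => \sum_j A i j * (a == mie j)%:R.

Lemma linmap_mie A i j : linmap A i (mie j) = A i j.
Proof.
rewrite /linmap (bigD1 j) //= eqxx mulr1 big1 ?addr0 // => k /negPf kj.
by rewrite (inj_eq (@mie_inj n)) eq_sym kj mulr0.
Qed.

Lemma linmap_linear A : is_linear_map (linmap A).
Proof.
move=> i a a1; rewrite /linmap big1 // => j _; case: eqP => [aj|]; last by rewrite mulr0.
by case: a1; rewrite aj deg_mie.
Qed.

Lemma fixes0_linmap A : fixes0 (linmap A).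
Proof. by move=> i; apply: linmap_linear; rewrite deg_mi0. Qed.

Lemma linpart_linmap A : linpart (linmap A) = A.
Proof. by apply/matrixP => i j; rewrite mxE linmap_mie. Qed.

Lemma linear_linmap F : is_linear_map F -> F = linmap (linpart F).
Proof.
move=> linF; apply: psmap_eq => i a; case: (eqVneq (deg a) 1%N) => [|/eqP a1].
  by case/deg_eq1 => j ->; rewrite linmap_mie mxE.
by rewrite linF // linmap_linear.
Qed.

Lemma linmap_comp A G i a : fixes0 G ->
  mapcomp (linmap A) G i a = \sum_j A i j * G j a.
Proof.
move=> G0; rewrite /mapcomp (pscompE _ G0 (leq_maxl (deg a) 1)).
transitivity (\sum_j \sum_(b <- midegs n (maxn (deg a) 1))
   A i j * monpow G b a * (b == mie j)%:R).
  rewrite exchange_big; apply: eq_bigr => b _.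
  by rewrite mulr_suml; apply: eq_bigr => j _; rewrite mulrAC.
apply: eq_bigr => j _; rewrite sum_delta ?midegs_uniq //.
by rewrite mem_midegs deg_mie leq_maxr mulr1 monpow_mie.
Qed.

(** Only terms of [F] of degree at most 1 reach the degree 1 coefficients of the composite, so [F]
    may be replaced by the linear map of its linear part. *)
Lemma linpart_comp F G : fixes0 F -> fixes0 G ->
  linpart (mapcomp F G) = linpart F *m linpart G.
Proof.
move=> F0 G0; apply/matrixP => i j; rewrite !mxE.
transitivity (mapcomp (linmap (linpart F)) G i (mie j)); last first.
  by rewrite linmap_comp //; apply: eq_bigr => k _; rewrite !mxE.
rewrite /mapcomp !(pscompE _ G0 (leqnn _)) big_seq [RHS]big_seq.
apply: eq_bigr => b; rewrite mem_midegs deg_mie leq_eqVlt ltnS leqn0.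
case/orP => /eqP; first by case/deg_eq1 => k ->; rewrite linmap_mie mxE.
by move/deg_eq0 ->; rewrite F0 fixes0_linmap.
Qed.

Lemma linmapM A B : mapcomp (linmap A) (linmap B) = linmap (A *m B).
Proof.
rewrite -{2}(linpart_linmap A) -{2}(linpart_linmap B) -linpart_comp; last first.
- exact: fixes0_linmap.
- exact: fixes0_linmap.
apply: linear_linmap => i a a1; rewrite linmap_comp; last exact: fixes0_linmap.
by rewrite big1 // => j _; rewrite linmap_linear // mulr0.
Qed.

Lemma linmap_diag A : is_diag_mx A -> linmap A = diagmap (fun i => A i i).
Proof.
move=> /is_diag_mxP dA; apply: psmap_eq => i a.
rewrite /linmap (bigD1 i) //= big1 ?addr0 // => j ji.
by rewrite dA ?mul0r // eq_sym.
Qed.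

Lemma linmap1 : linmap 1%:M = @psid R n.
Proof.
rewrite linmap_diag ?scalar_mx_is_diag // psidE; apply: psmap_eq => i a.
by rewrite /diagmap mxE eqxx.
Qed.

Lemma linpart_psid : linpart (@psid R n) = 1%:M.
Proof. by rewrite -linmap1 linpart_linmap. Qed.

(** * Inversion of maps tangent to the identity *)

Section Inverse.
Variable G : psmap R n.
Hypotheses (G0 : fixes0 G) (G1 : linpart G = 1%:M).

(** The leading form of a monomial in [G] is the same monomial in the identity. *)
Lemma monpow_tangent b a : (deg a <= deg b)%N -> monpow G b a = (a == b)%:R.
Proof.
have Gid j : eq_lead 1 (G j) (psid R j).
  apply: eq_lead1 => // c; rewrite leq_eqVlt ltnS leqn0 => /orP [] /eqP.
    case/deg_eq1 => k ->; rewrite -linmap1 linmap_mie.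
    by rewrite -G1 mxE.
  by move/deg_eq0 ->; rewrite G0 fixes0_psid.
move=> ab; rewrite ((eq_lead_monpow b Gid).1 a ab) psidE monpow_diagmap /mono /weight.
by rewrite big1 ?mul1r // => j _; rewrite expr1n.
Qed.

(** By tangency, the equation [pscomp P G = Q] is unitriangular for the degree; its solutions are
    the fixed points of this map. *)
Definition inv_step Q P : ps R n := fun a =>
  Q a - \sum_(b <- midegs n (deg a) | (deg b < deg a)%N) P b * monpow G b a.

(** A step uses strictly lower degrees only, so a coefficient of degree [deg a] is final after
    [(deg a).+1] iterations; the seed 0 is immaterial. *)
Definition ps_solve Q : ps R n := fun a => iter (deg a).+1 (inv_step Q) (fun _ => 0) a.

Lemma iter_inv_step Q k l a : (deg a < k)%N -> (deg a < l)%N ->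
  iter k (inv_step Q) (fun _ => 0) a = iter l (inv_step Q) (fun _ => 0) a.
Proof.
elim: k l a => [//|k IH] [//|l] a ak al /=; rewrite /inv_step; congr (_ - _).
apply: eq_bigr => b ba; rewrite (IH l) //; exact: leq_trans ba _.
Qed.

Lemma ps_solveE Q : ps_solve Q = inv_step Q (ps_solve Q).
Proof.
apply: functional_extensionality => a; rewrite {1}/ps_solve /= /inv_step.
congr (_ - _); apply: eq_bigr => b ba; congr (_ * _).
exact: iter_inv_step.
Qed.

Lemma pscomp_solve Q : pscomp (ps_solve Q) G = Q.
Proof.
apply: functional_extensionality => a; rewrite (pscompE _ G0 (leqnn _)).
rewrite (bigID (fun b => deg b < deg a)%N) /=.
(* Among the terms of top degree only [b = a] survives, with coefficient 1. *)
suff -> : \sum_(b <- midegs n (deg a) | ~~ (deg b < deg a)%N)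
    ps_solve Q b * monpow G b a = ps_solve Q a.
  by rewrite {2}ps_solveE /inv_step addrC subrK.
transitivity (\sum_(b <- midegs n (deg a)) ps_solve Q b * (b == a)%:R).
  rewrite big_mkcond; apply: eq_bigr => b _; case: ltnP => [ab|ba] /=.
    by case: eqP ab => [->|_ _]; rewrite ?ltnn ?mulr0.
  by rewrite monpow_tangent // eq_sym.
by rewrite sum_delta ?midegs_uniq // mem_midegs leqnn mulr1.
Qed.

Lemma tangent_left_inverse :
  exists F, [/\ fixes0 F, linpart F = 1%:M & mapcomp F G = @psid R n].
Proof.
pose F : psmap R n := fun i => ps_solve (psid R i).
have F0 : fixes0 F.
  by move=> i; rewrite /F ps_solveE /inv_step fixes0_psid deg_mi0 big1 ?subrr.
have FG : mapcomp F G = @psid R n.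
  by apply: psmap_eq => i a; rewrite /mapcomp pscomp_solve.
exists F; split=> //.
by have := linpart_comp F0 G0; rewrite FG G1 mulmx1 linpart_psid.
Qed.

End Inverse.

(** The left inverse [F] is again tangent to the identity, hence has a left inverse [H]; then
    [H = H o F o G = G], so [F] is two-sided. *)
Lemma tangent_inverse G : fixes0 G -> linpart G = 1%:M ->
  exists F, [/\ fixes0 F, mapcomp F G = @psid R n & mapcomp G F = @psid R n].
Proof.
move=> G0 G1; have [F [F0 F1 FG]] := tangent_left_inverse G0 G1.
have [H [H0 _ HF]] := tangent_left_inverse F0 F1.
have HG : H = G by rewrite -(mapcomp_idr H) -FG mapcompA // HF mapcomp_idl.
by exists F; split; rewrite // -HG.
Qed.

End PowerSeries.

(** * Formal inverses and the formal inverse function theorem *)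

Lemma formal_inverseP (R : comNzRingType) n (phi psi : psmap R n) :
  formal_inverse phi psi <->
  [/\ fixes0 phi, fixes0 psi, mapcomp phi psi = @psid R n & mapcomp psi phi = @psid R n].
Proof.
split=> [[phi0 [psi0 [/psmap_eq e1 /psmap_eq e2]]]|[phi0 psi0 e1 e2]] //.
by do !split=> //; move=> i a; rewrite ?e1 ?e2.
Qed.

Lemma formal_inverse_linpart (R : comNzRingType) n (phi psi : psmap R n) :
  formal_inverse phi psi -> linpart phi *m linpart psi = 1%:M.
Proof.
by move=> /formal_inverseP [phi0 psi0 e _]; rewrite -linpart_comp // e linpart_psid.
Qed.

Lemma formal_inverse_function (R : comUnitRingType) n (psi : psmap R n) :
  fixes0 psi -> linpart psi \in unitmx -> exists phi, formal_inverse phi psi.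
Proof.
set A := linpart psi => psi0 uA; have iA0 := fixes0_linmap (invmx A).
have A0 := fixes0_linmap A.
(* Normalizing by the inverse of the linear part reduces to the tangent case. *)
pose G := mapcomp (linmap (invmx A)) psi.
have G0 : fixes0 G by apply: fixes0_comp.
have AG : mapcomp (linmap A) G = psi.
  by rewrite mapcompA // linmapM mulmxV // linmap1 mapcomp_idl.
have [|F [F0 FG GF]] := @tangent_inverse _ _ G G0.
  by rewrite linpart_comp // linpart_linmap mulVmx.
exists (mapcomp F (linmap (invmx A))); apply/formal_inverseP; split=> //.
- exact: fixes0_comp.
- by rewrite -mapcompA.
- by rewrite mapcompA // -AG -(mapcompA _ G0 F0) GF mapcomp_idr linmapM mulmxV // linmap1.
Qed.

(** * Projection onto resonant terms *)

Section Resonant.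
Variables (R : idomainType) (n : nat) (d : 'I_n -> R).
Implicit Types F G : psmap R n.

Definition resonant_part F : psmap R n :=
  fun i a => if weight d a == d i then F i a else 0.

(** On the term of exponent [a] in component [i], the right composition multiplies by [weight d a]
    and the left one by [d i]; resonance is their equality. *)
Lemma resonant_part_diagmap F : fixes0 F ->
  mapcomp (resonant_part F) (diagmap d) = mapcomp (diagmap d) (resonant_part F).
Proof.
move=> F0; apply: psmap_eq => i a; rewrite diagmap_comp.
  by rewrite /mapcomp pscomp_diagmap /resonant_part; case: eqP => [->|]; rewrite ?mulr0.
by move=> j; rewrite /resonant_part F0 if_same.
Qed.

Lemma resonant_part_comp F G : fixes0 G ->
  mapcomp G (diagmap d) = mapcomp (diagmap d) G ->
  mapcomp (resonant_part F) G = resonant_part (mapcomp F G).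
Proof.
move=> G0 Gd; have d0 := fixes0_diagmap d.
(* Since [G] commutes with the diagonal map, its monomial of exponent [b] is an eigenvector of
   eigenvalue [weight d b]. *)
have wG b a : weight d a * monpow G b a = weight d b * monpow G b a.
  have := pscomp_monpow (diagmap d) b G0.
  rewrite -Gd -pscomp_monpow // monpow_diagmap pscomp_mono //.
  by move/(congr1 (fun P => P a)); rewrite pscomp_diagmap.
apply: psmap_eq => i a; rewrite {2}/resonant_part /mapcomp !(pscompE _ G0 (leqnn _)).
transitivity (\sum_(b <- midegs n (deg a))
    (if weight d a == d i then F i b * monpow G b a else 0)).
  apply: eq_bigr => b _; rewrite /resonant_part.
  case: (eqVneq (monpow G b a) 0) => [->|m0]; first by rewrite !mulr0 if_same.
  (* A nonzero coefficient can be cancelled, so [a] and [b] have equal weight and are resonant for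
     component [i] together. *)
  by rewrite (mulIf m0 (wG b a)); case: ifP; rewrite ?mul0r.
by case: ifP => // _; rewrite big1.
Qed.

Lemma linpart_resonant_part F : linpart F = 1%:M -> linpart (resonant_part F) = 1%:M.
Proof.
move=> F1; apply/matrixP => i j; rewrite mxE /resonant_part.
have -> : F i (mie j) = (i == j)%:R by have := congr1 (fun M : 'M_n => M i j) F1; rewrite !mxE.
rewrite mxE; case: (eqVneq i j) => [<-|]; last by rewrite if_same.
suff -> : weight d (mie i) = d i by rewrite eqxx.
rewrite /weight (bigD1 i) //= ffunE eqxx expr1 big1 ?mulr1 // => k /negPf ki.
by rewrite ffunE ki.
Qed.

End Resonant.

(** * Semiconjugacies to the diagonal linear parts *)

Section Linearization.
Variables (K : fieldType) (n : nat).
Implicit Types (f phi psi : psmap K n) (A : 'M[K]_n).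

Lemma formally_linearizable_semiconj f A :
  fixes0 f -> formally_linearizable f -> A \in unitmx ->
  exists phi psi, [/\ formal_inverse phi psi, linpart psi = A &
    mapcomp psi f = mapcomp (linmap (A *m linpart f *m invmx A)) psi].
Proof.
move=> f0 [phi [psi [inv lin]]] uA.
have [phi0 psi0 phipsi psiphi] := (formal_inverseP _ _).1 inv.
have fphi0 : fixes0 (mapcomp f phi) by apply: fixes0_comp.
set B := linpart phi; set B' := linpart psi.
have BB' : B *m B' = 1%:M := formal_inverse_linpart inv.
have B'B : B' *m B = 1%:M by apply: mulmx1C.
have eL : mapcomp psi (mapcomp f phi) = linmap (B' *m (linpart f *m B)).
  by rewrite (linear_linmap lin) !linpart_comp.
have ef : mapcomp psi f = mapcomp (linmap (B' *m (linpart f *m B))) psi.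
  by rewrite -eL -!mapcompA // phipsi mapcomp_idr.
have l0 M := fixes0_linmap (M : 'M[K]_n).
(* As [B] inverts the linear part of [psi], left composition with [A *m B] makes the linear part
   exactly [A] and conjugates the linear model accordingly. *)
exists (mapcomp phi (linmap (B' *m invmx A))), (mapcomp (linmap (A *m B)) psi).
split.
- apply/formal_inverseP; split; try exact: fixes0_comp.
  + rewrite -mapcompA ?(mapcompA (linmap _)) ?linmapM //; last exact: fixes0_comp.
    have -> : B' *m invmx A *m (A *m B) = 1%:M.
      by rewrite mulmxA -(mulmxA B') mulVmx // mulmx1.
    by rewrite linmap1 mapcomp_idl.
  + rewrite -mapcompA ?(mapcompA psi) ?psiphi //; last exact: fixes0_comp.
    rewrite mapcomp_idl // linmapM.
    have -> : A *m B *m (B' *m invmx A) = 1%:M.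
      by rewrite mulmxA -(mulmxA A) BB' mulmx1 mulmxV.
    exact: linmap1.
- by rewrite linpart_comp // linpart_linmap -mulmxA BB' mulmx1.
- rewrite -mapcompA // ef !mapcompA // !linmapM; congr (mapcomp (linmap _) _).
  by rewrite !mulmxA -(mulmxA A B B') BB' mulmx1 mulmxKV.
Qed.

Lemma simult_semiconj (h : nat) (f : 'I_h -> psmap K n) A :
  (forall k, fixes0 (f k)) -> (forall k, formally_linearizable (f k)) ->
  A \in unitmx -> (forall k, is_diag_mx (A *m linpart (f k) *m invmx A)) ->
  (forall p q, mapcomp (f p) (f q) = mapcomp (f q) (f p)) ->
  exists psi, [/\ fixes0 psi, linpart psi = A & forall k,
    mapcomp psi (f k) = mapcomp (linmap (A *m linpart (f k) *m invmx A)) psi].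
Proof.
move=> f0 lin uA dA comm.
pose D k := linmap (A *m linpart (f k) *m invmx A).
have D0 k : fixes0 (D k) by apply: fixes0_linmap.
suff step m : (m <= h)%N -> exists psi, [/\ fixes0 psi, linpart psi = A &
    forall k : 'I_h, (k < m)%N -> mapcomp psi (f k) = mapcomp (D k) psi].
  by have [psi [psi0 psiA psif]] := step h (leqnn h); exists psi; split=> // k; apply: psif.
elim: m => [_|m IH mh].
  exists (linmap A); split=> //; [exact: fixes0_linmap | exact: linpart_linmap].
have [psi [psi0 psiA psif]] := IH (ltnW mh); pose k := Ordinal mh.
have [phik [psik [inv psikA psikf]]] := formally_linearizable_semiconj (f0 k) (lin k) uA.
have [phik0 psik0 phipsi psiphi] := (formal_inverseP _ _).1 inv.
rewrite -/(D k) in psikf.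
have Ddiag := linmap_diag (dA k); rewrite -/(D k) in Ddiag.
set d := (fun i => _) in Ddiag.
pose chi := mapcomp psi phik.
have chi0 : fixes0 chi by apply: fixes0_comp.
have rchi0 : fixes0 (resonant_part d chi).
  by move=> i; rewrite /resonant_part chi0 if_same.
(* These are the maps [f j] in coordinates linearizing [f k]; there [f k] becomes [diagmap d], and
   all of them commute with it. *)
pose g j := mapcomp psik (mapcomp (f j) phik).
have g0 j : fixes0 (g j) by do 2!apply: fixes0_comp => //.
have gpsi j : mapcomp (g j) psik = mapcomp psik (f j).
  by rewrite -!mapcompA ?phipsi ?mapcomp_idr //; apply: fixes0_comp.
have gk : g k = diagmap d.
  by rewrite /g mapcompA // psikf -mapcompA // psiphi mapcomp_idr.
have gg p q : mapcomp (g p) (g q) = mapcomp psik (mapcomp (mapcomp (f p) (f q)) phik).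
  rewrite {2}/g mapcompA ?gpsi -?mapcompA //; exact: fixes0_comp.
have gd j : mapcomp (g j) (diagmap d) = mapcomp (diagmap d) (g j).
  by rewrite -gk !gg comm.
exists (mapcomp (resonant_part d chi) psik); split.
- exact: fixes0_comp.
(* Both [psi] and [psik] have linear part [A], so [chi] is tangent to the identity, and so is its
   resonant part. *)
- rewrite linpart_comp // psikA linpart_resonant_part ?mul1mx //.
  rewrite linpart_comp // psiA -psikA.
  by apply: mulmx1C; apply: formal_inverse_linpart inv.
move=> j; rewrite ltnS leq_eqVlt => /orP [/eqP jm|jm].
  have -> : j = k by apply: val_inj.
  have d0 := fixes0_diagmap d.
  rewrite -mapcompA // psikf Ddiag (mapcompA _ d0 psik0) resonant_part_diagmap //.
  by rewrite -mapcompA.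
rewrite -mapcompA // -gpsi [LHS]mapcompA // [RHS]mapcompA //.
rewrite (resonant_part_comp chi (g0 j) (gd j)); congr (mapcomp _ psik).
(* For [j < m] the equation already solved by [psi] is transported to [chi] and [g j]. *)
have -> : mapcomp chi (g j) = mapcomp (D j) chi.
  have fphi0 : fixes0 (mapcomp (f j) phik) by apply: fixes0_comp.
  rewrite /chi -(mapcompA _ phik0 (g0 j)) (mapcompA phik psik0 fphi0) phipsi mapcomp_idl //.
  by rewrite mapcompA // psif // mapcompA.
(* Being diagonal, [D j] rescales each component by a constant, which commutes with selecting
   terms. *)
rewrite /D (linmap_diag (dA j)); apply: psmap_eq => i a.
by rewrite diagmap_comp // /resonant_part diagmap_comp //; case: ifP; rewrite ?mulr0.
Qed.

End Linearization.

(** * Equivalence of simultaneous linearization and commutation *)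

Theorem theorem2p4 (C : numClosedFieldType) (n h : nat)
  (f : 'I_h -> psmap C n) :
  (2 <= h)%N ->
  (forall k, germ_biholo_0 (f k)) ->
  (forall k, formally_linearizable (f k)) ->
  simult_diag_linparts f ->
  (simult_formally_linearizable f <->
   forall p q, meq (mapcomp (f p) (f q)) (mapcomp (f q) (f p))).
Proof.
move=> _ germ lin [A [uA dA]].
have f0 k : fixes0 (f k) by case: (germ k).
(* Simultaneously diagonalizable matrices commute, because diagonal ones do. *)
have lcomm p q : linpart (f p) *m linpart (f q) = linpart (f q) *m linpart (f p).
  pose P k := A *m linpart (f k) *m invmx A.
  have PE k : linpart (f k) = invmx A *m P k *m A.
    by rewrite /P !mulmxA mulVmx // mul1mx mulmxKV.
  have PC : P p *m P q = P q *m P p.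
    have /diag_mxP [u Pu] := dA p; have /diag_mxP [v Pv] := dA q.
    by rewrite /P Pu Pv diag_mxC.
  have conjM X Y : invmx A *m X *m A *m (invmx A *m Y *m A) = invmx A *m (X *m Y) *m A.
    by rewrite !mulmxA mulmxK.
  by rewrite (PE p) (PE q) !conjM PC.
split=> [[phi [psi [inv linf]]] p q i a|comm].
  have [phi0 psi0 phipsi psiphi] := (formal_inverseP _ _).1 inv.
  pose L k := mapcomp psi (mapcomp (f k) phi).
  have fL k : f k = mapcomp phi (mapcomp (L k) psi).
    rewrite /L !mapcompA ?phipsi ?mapcomp_idl //; try by do ?apply: fixes0_comp.
    by rewrite -mapcompA // phipsi mapcomp_idr.
  (* By the chain rule each linear model is conjugate to the linear part, through a matrix common to
     all [k]; commutation of the [f k] thus reduces to [lcomm]. *)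
  have LE k : L k = linmap (linpart psi *m linpart (f k) *m linpart phi).
    by rewrite /L (linear_linmap (linf k)) !linpart_comp ?mulmxA //; apply: fixes0_comp.
  have L0 k : fixes0 (L k) by rewrite LE; apply: fixes0_linmap.
  have ff p' q' : mapcomp (f p') (f q') = mapcomp phi (mapcomp (mapcomp (L p') (L q')) psi).
    have Lpsi0 k : fixes0 (mapcomp (L k) psi) by apply: fixes0_comp.
    rewrite (fL p') {1}(fL q') -mapcompA -?(mapcompA (L p')) //; try exact: fixes0_comp.
    by rewrite (mapcompA psi phi0) // psiphi mapcomp_idl // mapcompA.
  rewrite !ff !LE !linmapM.
  have BB' := formal_inverse_linpart inv.
  have mid X Y : linpart psi *m X *m linpart phi *m (linpart psi *m Y *m linpart phi) =
      linpart psi *m (X *m Y) *m linpart phi.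
    by rewrite !mulmxA -(mulmxA _ (linpart phi)) BB' mulmx1.
  by rewrite !mid lcomm.
have [|psi [psi0 psiA psif]] := simult_semiconj f0 lin uA dA.
  by move=> p q; apply: psmap_eq.
(* The common semiconjugacy has invertible linear part [A], so it is a formal change of
   coordinates. *)
have [phi inv] : exists phi, formal_inverse phi psi.
  by apply: formal_inverse_function; rewrite ?psiA.
exists phi, psi; split=> // k.
have [phi0 _ _ psiphi] := (formal_inverseP _ _).1 inv.
rewrite mapcompA // psif -mapcompA // psiphi mapcomp_idr; exact: linmap_linear.
Qed.
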